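(* Let $M$ be a closed Riemannian manifold of dimension $n\ge 3$, let $X$ be a $C^1$-vector field on $M$, and let $\Lambda\subset M$ be a compact isolated set for $X$ which is not a periodic orbit or a singularity of $X$. If $X$ has the (two-sided) limit shadowing property with a gap in $\Lambda$, then $X$ is topologically transitive in $\Lambda$ and has the shadowing property in $\Lambda$.
   Context: $X_t$ ($t\in\mathbb{R}$) denotes the flow of $X$ and $d$ the Riemannian distance on $M$. An invariant set $\Lambda\subset M$ is isolated for $X$ if there is an open set $U\subset M$ with $\Lambda=\bigcap_{t\in\mathbb{R}}X_t(U)$. A sequence $\{(x_i,t_i)\}$ is said to be in $\Lambda$ if all $x_i\in\Lambda$. Limit shadowing with a gap. A sequence $\{(x_i,t_i)\}_{i\in\mathbb{Z}}$ of points $x_i\in M$ and real numbers $t_i$ is a (two-sided) limit-pseudo orbit of $X$ if $t_i\ge1$ for every $i\in\mathbb{Z}$ and $\lim_{|i|\to\infty}d(X_{t_i}(x_i),x_{i+1})=0$. Put $s_0=0$, $s_n=\sum_{i=0}^{n-1}t_i$ and $s_{-n}=\sum_{i=-n}^{-1}t_i$ for integers $n\ge1$. A limit-pseudo orbit in $\Lambda$ is (two-sided) limit shadowed with gap $K\in\mathbb{R}$ if there is a point $z\in\Lambda$ such that $$\lim_{i\to\infty}\int_{s_i}^{s_{i+1}}d(X_{t+K}(z),X_{t-s_i}(x_i))\,dt=0,\qquad \lim_{i\to\infty}\int_{-s_{-i}}^{-s_{-(i-1)}}d(X_t(z),X_{t+s_{-i}}(x_{-i}))\,dt=0 .$$ For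 $N\in[0,\infty)$, $X$ has the (two-sided) limit shadowing property with gap $N$ in $\Lambda$ if every limit-pseudo orbit of $X$ in $\Lambda$ is (two-sided) limit shadowed with gap $K$ for some $K\in\mathbb{R}$ with $|K|\le N$. If such an $N\in[0,\infty)$ exists, $X$ has the (two-sided) limit shadowing property with a gap in $\Lambda$. Shadowing. For $\delta>0$, a $\delta$-pseudo orbit of $X$ is a sequence $\{(x_i,t_i)\}_{i\in\mathbb{Z}}$ of points $x_i\in M$ and positive integers $t_i$ such that $d(X_{t_i}(x_i),x_{i+1})<\delta$ for all $i\in\mathbb{Z}$. Put $\sigma_0=0$, $\sigma_n=\sum_{i=0}^{n-1}t_i$ and $\sigma_{-n}=-\sum_{i=-n}^{-1}t_i$ for integers $n\ge1$. It is $\varepsilon$-shadowed by the orbit through $x$ if there is an orientation preserving homeomorphism $h:\mathbb{R}\to\mathbb{R}$ with $h(0)=0$ such that $d(X_{h(t)}(x),X_{t-\sigma_i}(x_i))<\varepsilon$ for all $\sigma_i\le t\le\sigma_{i+1}$ and all $i\in\mathbb{Z}$. $X$ has the shadowing property in $\Lambda$ if for every $\varepsilon>0$ there is $\delta>0$ such that every $\delta$-pseudo orbit of $X$ in $\Lambda$ is $\varepsilon$-shadowed by the orbit of $X$ through some point of $\Lambda$. Transitivity. $X$ is topologically transitive in $\Lambda$ if for any nonempty (relatively) open subsets $U$ and $V$ of $\Lambda$ there is $t\in\mathbb{R}$ with $X_t(U)\cap V\ne\emptyset$. *)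

(* Defs.v *)
From HB Require Import structures.
From mathcomp Require Import all_boot all_order all_algebra.
From mathcomp Require Import all_classical all_reals all_analysis.

Set Implicit Arguments.
Unset Strict Implicit.
Unset Printing Implicit Defensive.

Import Order.TTheory GRing.Theory Num.Theory.
Import numFieldNormedType.Exports.

Local Open Scope classical_set_scope.
Local Open Scope ring_scope.

(* [f] is of class C^k on [U], meant for an open [U]: all iterated partial
   derivatives of order at most [k] exist and are continuous on [U]. *)
Fixpoint Ck_on (R : realType) (n : nat) (V : normedModType R) (k : nat)
    (U : set 'rV[R]_n) (f : 'rV[R]_n -> V) : Prop :=
  (forall u, U u -> {for u, continuous f}) /\
  match k with
  | 0%N => True
  | k'.+1 => forall j : 'I_n,
      (forall u, U u -> derivable f u (delta_mx 0 j)) /\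
      Ck_on k' U ('D_(delta_mx 0 j) f)
  end.

(* A C^oo atlas without boundary.  Charts [chart_map c] and their inverses
   [chart_inv c] are total functions, meaningful only on [chart_dom c] and on
   [chart_map c @` chart_dom c]; [chart_at p] is a chosen chart around [p]. *)
Record smooth_atlas (R : realType) (n : nat) (M : topologicalType) := SmoothAtlas {
  chart_index : Type ;
  chart_dom : chart_index -> set M ;
  chart_map : chart_index -> M -> 'rV[R]_n ;
  chart_inv : chart_index -> 'rV[R]_n -> M ;
  chart_at : M -> chart_index ;
  mem_chart_at : forall p, chart_dom (chart_at p) p ;
  chart_dom_open : forall c, open (chart_dom c) ;
  chart_codom_open : forall c, open (chart_map c @` chart_dom c) ;
  chart_mapK : forall c p, chart_dom c p -> chart_inv c (chart_map c p) = p ;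
  chart_map_continuous : forall c p, chart_dom c p -> {for p, continuous (chart_map c)} ;
  chart_inv_continuous : forall c u, (chart_map c @` chart_dom c) u ->
    {for u, continuous (chart_inv c)} ;
  transition_smooth : forall c c' k,
    Ck_on k (chart_map c @` (chart_dom c `&` chart_dom c')) (chart_map c' \o chart_inv c)
}.

(* Jacobian at [p] of the change of coordinates from [c] to [c'].  Tangent
   vectors are row vectors, on which ['J] acts by multiplication on the right. *)
Definition transition_jacobian (R : realType) (n : nat) (M : topologicalType)
    (A : smooth_atlas R n M) (c c' : chart_index A) (p : M) : 'M[R]_n :=
  'J (chart_map c' \o chart_inv c) (chart_map c p).

(* A vector field is given by its components in each chart. *)
Record vector_field (R : realType) (n : nat) (M : topologicalType)
    (A : smooth_atlas R n M) := VectorField {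
  vcomp : chart_index A -> M -> 'rV[R]_n ;
  vcomp_change : forall c c' p, chart_dom c p -> chart_dom c' p ->
    vcomp c' p = vcomp c p *m transition_jacobian c c' p
}.

Definition C1_vector_field (R : realType) (n : nat) (M : topologicalType)
    (A : smooth_atlas R n M) (X : vector_field A) : Prop :=
  forall c : chart_index A, Ck_on 1 (chart_map c @` chart_dom c) (vcomp X c \o chart_inv c).

(* A smooth Riemannian metric is given by its Gram matrix in each chart. *)
Record riemannian_metric (R : realType) (n : nat) (M : topologicalType)
    (A : smooth_atlas R n M) := RiemannianMetric {
  gram : chart_index A -> M -> 'M[R]_n ;
  gram_sym : forall c p, chart_dom c p -> (gram c p)^T = gram c p ;
  gram_posdef : forall c p (v : 'rV[R]_n), chart_dom c p -> v != 0 ->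
    0 < (v *m gram c p *m v^T) 0 0 ;
  gram_smooth : forall c k, Ck_on k (chart_map c @` chart_dom c) (gram c \o chart_inv c) ;
  gram_change : forall c c' p, chart_dom c p -> chart_dom c' p ->
    gram c p = transition_jacobian c c' p *m gram c' p *m
               (transition_jacobian c c' p)^T
}.

Definition C1_curve_at (R : realType) (n : nat) (M : topologicalType)
    (A : smooth_atlas R n M) (gamma : R -> M) (t : R) : Prop :=
  let f : R -> 'rV[R]_n := chart_map (chart_at A (gamma t)) \o gamma in
  [/\ {for t, continuous gamma},
      \forall s \near t, derivable f s 1
    & {for t, continuous (derive1 f)}].

(* A C^1 piece on a closed interval is one that extends to a C^1 curve around
   each point of this interval. *)
Definition piecewise_C1 (R : realType) (n : nat) (M : topologicalType)
    (A : smooth_atlas R n M) (gamma : R -> M) : Prop :=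
  {within `[0, 1], continuous gamma} /\
  exists (k : nat) (a : nat -> R),
    [/\ a 0%N = 0, a k = 1 &
        forall j, (j < k)%N -> a j < a j.+1 /\
          exists sigma : R -> M, forall t, a j <= t <= a j.+1 ->
            C1_curve_at A sigma t /\ sigma t = gamma t].

Definition speed (R : realType) (n : nat) (M : topologicalType)
    (A : smooth_atlas R n M) (g : riemannian_metric A) (gamma : R -> M) (t : R) : R :=
  let c := chart_at A (gamma t) in
  let v : 'rV[R]_n := derive1 (chart_map c \o gamma) t in
  Num.sqrt ((v *m gram g c (gamma t) *m v^T) 0 0).

Definition curve_length (R : realType) (n : nat) (M : topologicalType)
    (A : smooth_atlas R n M) (g : riemannian_metric A) (gamma : R -> M) : \bar R :=
  (\int[lebesgue_measure]_(t in `[0%R, 1%R]) (speed g gamma t)%:E)%E.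

Definition riemannian_distance (R : realType) (n : nat) (M : topologicalType)
    (A : smooth_atlas R n M) (g : riemannian_metric A) (x y : M) : \bar R :=
  ereal_inf [set curve_length g gamma | gamma in
    [set gamma | [/\ piecewise_C1 A gamma, gamma 0 = x & gamma 1 = y]]].

(* The closed (compact, without boundary) Riemannian manifolds.  The manifold
   is given as a metric space, whose distance [mdist] is required to be the
   Riemannian one; as usual the manifold topology is the one induced by it.
   Since [mdist] is finite, any two points are joined by a curve, so that [M]
   is connected. *)
Definition closed_riemannian_manifold (R : realType) (n : nat) (M : metricType R)
    (A : smooth_atlas R n M) (g : riemannian_metric A) : Prop :=
  compact [set: M] /\
  forall x y : M, (mdist x y)%:E = riemannian_distance g x y.

(* [phi t x] stands for X_t(x): the continuous action of the real line whose
   orbits are the integral curves of [X]. *)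
Definition is_flow_of (R : realType) (n : nat) (M : topologicalType)
    (A : smooth_atlas R n M) (X : vector_field A) (phi : R -> M -> M) : Prop :=
  [/\ forall x, phi 0 x = x,
      forall s t x, phi (s + t) x = phi s (phi t x),
      continuous (fun tx : R * M => phi tx.1 tx.2)
    & forall (x : M) (t : R) (c : chart_index A), chart_dom c (phi t x) ->
        is_derive t 1 (fun s : R => chart_map c (phi s x)) (vcomp X c (phi t x))].

Definition singularity (R : realType) (n : nat) (M : topologicalType)
    (A : smooth_atlas R n M) (X : vector_field A) (p : M) : Prop :=
  forall c : chart_index A, chart_dom c p -> vcomp X c p = 0.

Definition orbit_of (R : realType) (M : Type) (phi : R -> M -> M) (p : M) : set M :=
  [set phi t p | t in [set: R]].

Definition periodic_point (R : realType) (n : nat) (M : topologicalType)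
    (A : smooth_atlas R n M) (X : vector_field A) (phi : R -> M -> M) (p : M) : Prop :=
  ~ singularity X p /\ exists2 T : R, 0 < T & phi T p = p.

Definition is_singularity_set (R : realType) (n : nat) (M : topologicalType)
    (A : smooth_atlas R n M) (X : vector_field A) (L : set M) : Prop :=
  exists2 p, singularity X p & L = [set p].

Definition is_periodic_orbit (R : realType) (n : nat) (M : topologicalType)
    (A : smooth_atlas R n M) (X : vector_field A) (phi : R -> M -> M)
    (L : set M) : Prop :=
  exists2 p, periodic_point X phi p & L = orbit_of phi p.

Definition invariant_set (R : realType) (M : Type) (phi : R -> M -> M)
    (L : set M) : Prop :=
  forall t, phi t @` L = L.

Definition isolated_set (R : realType) (M : topologicalType) (phi : R -> M -> M)
    (L : set M) : Prop :=
  invariant_set phi L /\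
  exists2 U : set M, open U & L = \bigcap_(t in [set: R]) (phi t @` U).

Definition relatively_open (M : topologicalType) (L U : set M) : Prop :=
  exists2 O : set M, open O & U = L `&` O.

Definition topologically_transitive (R : realType) (M : topologicalType)
    (phi : R -> M -> M) (L : set M) : Prop :=
  forall U V : set M, relatively_open L U -> relatively_open L V ->
    U !=set0 -> V !=set0 -> exists t : R, (phi t @` U) `&` V !=set0.

(* The unsigned sums: s_n = t_0 + ... + t_(n-1) and
   s_(-n) = t_(-n) + ... + t_(-1), both nonnegative when [t] is. *)
Definition abs_time (R : realType) (t : int -> R) (i : int) : R :=
  match i with
  | Posz n => \sum_(0 <= k < n) t (k%:Z)
  | Negz n => \sum_(0 <= k < n.+1) t (- (k.+1)%:Z)
  end.

Definition limit_pseudo_orbit (R : realType) (M : metricType R)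
    (phi : R -> M -> M) (x : int -> M) (t : int -> R) : Prop :=
  (forall i, 1 <= t i) /\
  forall e : R, 0 < e -> exists N : nat, forall i : int, (N <= `|i|)%N ->
    mdist (phi (t i) (x i)) (x (i + 1)) < e.

Definition limit_shadowed_by (R : realType) (M : metricType R)
    (phi : R -> M -> M) (x : int -> M) (t : int -> R) (K : R) (z : M) : Prop :=
  let s := abs_time t in
  ((fun i : nat =>
     \int[lebesgue_measure]_(u in `[s i%:Z, s (i%:Z + 1)])
        mdist (phi (u + K) z) (phi (u - s i%:Z) (x i%:Z))) @ \oo --> (0 : R)) /\
  ((fun i : nat =>
     \int[lebesgue_measure]_(u in `[- s (- i%:Z), - s (- (i%:Z - 1))])
        mdist (phi u z) (phi (u + s (- i%:Z)) (x (- i%:Z)))) @ \oo --> (0 : R)).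

Definition limit_shadowing_with_gap (R : realType) (M : metricType R)
    (phi : R -> M -> M) (L : set M) (N : R) : Prop :=
  forall (x : int -> M) (t : int -> R),
    limit_pseudo_orbit phi x t -> (forall i, L (x i)) ->
    exists2 K : R, `|K| <= N & exists2 z, L z & limit_shadowed_by phi x t K z.

Definition limit_shadowing_with_a_gap (R : realType) (M : metricType R)
    (phi : R -> M -> M) (L : set M) : Prop :=
  exists2 N : R, 0 <= N & limit_shadowing_with_gap phi L N.

Definition pseudo_orbit (R : realType) (M : metricType R) (phi : R -> M -> M)
    (delta : R) (x : int -> M) (t : int -> nat) : Prop :=
  forall i, (0 < t i)%N /\ mdist (phi (t i)%:R (x i)) (x (i + 1)) < delta.

(* The signed sums: unlike [abs_time], negative indices give negative times. *)
Definition signed_time (R : realType) (t : int -> nat) (i : int) : R :=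
  let s := abs_time (fun j => (t j)%:R) in
  if (0 <= i)%R then s i else - s i.

Definition orientation_preserving_homeo (R : realType) (h : R -> R) : Prop :=
  {homo h : s t / s < t} /\
  exists k : R -> R, [/\ cancel h k, cancel k h, continuous h & continuous k].

Definition shadowed_by (R : realType) (M : metricType R) (phi : R -> M -> M)
    (eps : R) (x : int -> M) (t : int -> nat) (z : M) : Prop :=
  exists h : R -> R, [/\ orientation_preserving_homeo h, h 0 = 0 &
    forall (i : int) (u : R), signed_time R t i <= u <= signed_time R t (i + 1) ->
      mdist (phi (h u) z) (phi (u - signed_time R t i) (x i)) < eps].

Definition shadowing_property (R : realType) (M : metricType R)
    (phi : R -> M -> M) (L : set M) : Prop :=
  forall eps : R, 0 < eps -> exists2 delta : R, 0 < delta &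
    forall (x : int -> M) (t : int -> nat),
      pseudo_orbit phi delta x t -> (forall i, L (x i)) ->
      exists2 z, L z & shadowed_by phi eps x t z.

(* Main.v *)
Require Import Defs.
From mathcomp Require Import all_boot all_order all_algebra.
From mathcomp Require Import all_classical all_reals all_analysis.
From mathcomp Require Import lra zify.

Set Implicit Arguments.
Unset Strict Implicit.
Unset Printing Implicit Defensive.

Import Order.TTheory GRing.Theory Num.Theory.
Import numFieldNormedType.Exports.

Local Open Scope classical_set_scope.
Local Open Scope ring_scope.

(** Why the theorem holds.  Let [phi] be the flow and [L] the compact invariant
    set.

    Integrals versus distances.  By compactness, points of [L] move little in a
    short time, uniformly; so a distance between two orbits of [L] that is not
    small at some instant stays bounded below on an interval of fixed length.
    As the jump times are at least 1, the vanishing integrals of the limit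
    shadowing property therefore give uniform closeness on each piece
    ([uniform_of_small_integral], [limit_shadowing_joins]).

    Chains.  Let [x] and [y] be in [L].  The omega-limit set of [x] contains a
    full orbit, of [p] say, and the alpha-limit set of [y] contains the orbit of
    some [q].  Following [p] for negative times and [q] for nonnegative times is
    a limit-pseudo orbit with a single jump; a point [z] shadowing it is
    backward asymptotic to [p] and, up to the shift [K], forward asymptotic to
    [q].  So [x] flows close to the past of [p], one jumps to the past of [z],
    flows to the future of [z], jumps close to the future of [q], that is to the
    past of [y], and flows to [y]: the set [L] is chain transitive
    ([connecting_chain]).

    Finite shadowing.  Suppose that for some [e] there is, for every [k], a
    finite pseudo orbit with jumps below [1/(k+1)] that no point of [L] traces
    within [e].  Chain transitivity links these blocks into one infinite
    limit-pseudo orbit.  If [z] shadows it with gap [K], then for every late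
    block a suitable point of the orbit of [z] traces this block within [e]: a
    contradiction ([finite_shadowing]).  The gap does no harm, since it only
    changes which point of the orbit of [z] is taken.

    Conclusion.  Tracing a chain from [x] to [y] by an orbit of [L] gives
    transitivity.  A bi-infinite pseudo orbit is traced on each finite window by
    a point of [L], and a cluster point of these points traces it everywhere,
    the homeomorphism of the time line being the identity. *)

(** * Distances and integrals *)

Lemma le_mdist4 (R : realType) (M : metricType R) (a b a' b' : M) :
  mdist a b <= mdist a a' + mdist a' b' + mdist b b'.
Proof.
have h1 := metric_triangle a a' b; have h2 := metric_triangle a' b' b.
by rewrite (metric_sym b b'); lra.
Qed.

Lemma continuous_mdist (R : realType) (T : topologicalType) (M : metricType R)
    (f g : T -> M) :
  continuous f -> continuous g -> continuous (fun x => mdist (f x) (g x) : R).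
Proof.
move=> cf cg x; apply/cvgrPdist_lt => e e0.
have e20 : 0 < e / 2 by rewrite divr_gt0.
near=> y.
have h1 : mdist (f x) (f y) < e / 2.
  by near: y; exact: (metricType_numDomainType.cvgr_dist_lt (cf x)).
have h2 : mdist (g x) (g y) < e / 2.
  by near: y; exact: (metricType_numDomainType.cvgr_dist_lt (cg x)).
have h3 := le_mdist4 (f x) (g x) (f y) (g y).
have h4 := le_mdist4 (f y) (g y) (f x) (g x).
rewrite (metric_sym (f y) (f x)) (metric_sym (g y) (g x)) in h4.
by rewrite ltr_norml; apply/andP; split; lra.
Unshelve. all: by end_near. Qed.

Lemma Rintegral_ge_subitv (R : realType) (f : R -> R) (a b a' b' c : R) :
  continuous f -> (forall x, 0 <= f x) -> a <= a' -> a' <= b' -> b' <= b ->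
  (forall x, a' <= x <= b' -> c <= f x) ->
  c * (b' - a') <= \int[lebesgue_measure]_(x in `[a, b]) f x.
Proof.
move=> cf f0 aa' ab' bb' cfx.
have fint u v : lebesgue_measure.-integrable `[u, v] (EFin \o f).
  apply: continuous_compact_integrable; first exact: segment_compact.
  exact: continuous_subspaceT.
have -> : c * (b' - a') = \int[lebesgue_measure]_(x in `[a', b']) c.
  rewrite Rintegral_cst//= lebesgue_measure_itv/= lte_fin.
  case: ltP => [_|h]; first by rewrite -EFinB.
  have -> : b' = a' by apply/le_anti; rewrite h ab'.
  by rewrite subrr.
apply: (@le_trans _ _ (\int[lebesgue_measure]_(x in `[a', b']) f x)).
  apply: le_Rintegral => //.
    apply: (@continuous_compact_integrable _ (cst c)).
      exact: segment_compact.
    by apply: continuous_subspaceT => x; exact: cvg_cst.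
apply: fine_le.
- exact: integrable_fin_num.
- exact: integrable_fin_num.
apply: ge0_subset_integral => //.
- by have /integrableP[] := fint a b.
- by move=> x _; rewrite lee_fin.
- by move=> x /=; rewrite !in_itv/= => /andP[h1 h2]; apply/andP; split; lra.
Qed.

(** * Continuous flows *)

Definition continuous_flow (R : realType) (M : topologicalType)
    (phi : R -> M -> M) : Prop :=
  [/\ forall x, phi 0 x = x,
      forall s t x, phi (s + t) x = phi s (phi t x)
    & continuous (fun tx : R * M => phi tx.1 tx.2)].

Section Flow.
Context {R : realType} {M : metricType R} {phi : R -> M -> M}.
Hypothesis flow : continuous_flow phi.

Let phi0 x : phi 0 x = x. Proof. by case: flow. Qed.
Let phiD s t x : phi (s + t) x = phi s (phi t x). Proof. by case: flow. Qed.

Lemma reverse_flow : continuous_flow (fun t => phi (- t)).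
Proof.
split=> [x|s t x|]; first by rewrite oppr0.
  by rewrite opprD phiD.
case: flow => _ _ c [t x].
apply: (@continuous_comp _ _ _ (fun tx : R * M => (- tx.1, tx.2))
  (fun tx : R * M => phi tx.1 tx.2)); last exact: c.
have h1 : (fun tx : R * M => - tx.1) @ nbhs (t, x) --> - t.
  by apply: cvgN; exact: cvg_fst.
have h2 : snd @ nbhs (t, x) --> x by exact: cvg_snd.
exact: (cvg_pair h1 h2).
Qed.

Lemma flow_continuous_time x : continuous (phi ^~ x).
Proof.
case: flow => _ _ c t.
apply: (@continuous_comp _ _ _ (fun t : R => (t, x))
  (fun tx : R * M => phi tx.1 tx.2)); last exact: c.
exact: (cvg_pair (@cvg_id _ (nbhs t)) (@cvg_cst _ x _ (nbhs t) _)).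
Qed.

Lemma flow_continuous_space t : continuous (phi t).
Proof.
case: flow => _ _ c x.
apply: (@continuous_comp _ _ _ (fun x : M => (t, x))
  (fun tx : R * M => phi tx.1 tx.2)); last exact: c.
exact: (cvg_pair (@cvg_cst _ t _ (nbhs x) _) (@cvg_id _ (nbhs x))).
Qed.

(** This is where compactness enters: near each point of [L] small times act by
    small displacements, and finitely many such neighbourhoods cover [L]. *)
Lemma small_time_displacement (L : set M) (e : R) : compact L -> 0 < e ->
  exists2 eta : R, 0 < eta <= 2^-1 &
    forall x s, L x -> `|s| <= eta -> mdist x (phi s x) < e.
Proof.
move=> /compact_near_coveringP cL e0.
have e20 : 0 < e / 2 by rewrite divr_gt0.
have : \forall s \near (0 : R), L `<=` (fun x => mdist x (phi s x) < e).
  apply: (cL R (nbhs (0 : R)) (fun s x => mdist x (phi s x) < e) _) => x _.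
  have c : \forall tx \near ((0 : R), x), mdist x (phi tx.1 tx.2) < e / 2.
    case: flow => _ _ /(_ (0, x)) /= c.
    have := metricType_numDomainType.cvgr_dist_lt c e20.
    by rewrite /= phi0; exact.
  case: c => -[A B] /= [A0 Bx] AB.
  exists (B `&` [set y | mdist x y < e / 2], A) => /=.
    split=> //; apply: filterI => //.
    exact: (metricType_numDomainType.cvgr_dist_lt (@cvg_id _ (nbhs x)) e20).
  move=> [y s] /= [[By xy] As].
  have := AB (s, y) (conj As By); rewrite /= => h.
  by have := metric_triangle y x (phi s y); rewrite (metric_sym y x); lra.
move=> /nbhs_ballP[r /= r0 rL].
exists (Num.min (r / 2) 2^-1).
  rewrite lt_min ge_min lexx orbT andbT invr_gt0 ltr0n andbT.
  by rewrite divr_gt0.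
move=> x s Lx sr; apply: (rL s) => //.
rewrite /ball/= sub0r normrN (le_lt_trans sr)// gt_min; apply/orP; left; lra.
Qed.

(** If the distance at [u] were at least [e], then it would be at least [e / 3]
    at every time within [eta] of [u], because each of the two points moves by
    less than [e / 3] meanwhile.  An interval of length at least 1 contains one
    of [u, u + eta] and [u - eta, u], hence the threshold [e / 3 * eta]. *)
Lemma uniform_of_small_integral (L : set M) (e : R) :
  compact L -> (forall t x, L x -> L (phi t x)) -> 0 < e ->
  exists2 d : R, 0 < d & forall x y a b K c, L x -> L y -> 1 <= b - a ->
    \int[lebesgue_measure]_(u in `[a, b])
      mdist (phi (u + K) x) (phi (u - c) y) < d ->
    forall u, a <= u <= b -> mdist (phi (u + K) x) (phi (u - c) y) < e.
Proof.
move=> cL Linv e0.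
have e30 : 0 < e / 3 by rewrite divr_gt0.
have [eta /andP[eta0 eta2] small] := small_time_displacement cL e30.
exists (e / 3 * eta); first by rewrite mulr_gt0.
move=> x y a b K c Lx Ly ab.
pose f v := mdist (phi (v + K) x) (phi (v - c) y).
move=> hint u /andP[au ub]; rewrite -/(f u).
have int_lt : \int[lebesgue_measure]_(v in `[a, b]) f v < e / 3 * eta := hint.
rewrite ltNge; apply/negP => feu.
have far v : `|v - u| <= eta -> e / 3 <= f v.
  move=> vu.
  have h1 := small (phi (u + K) x) (v - u) (Linv _ _ Lx) vu.
  have h2 := small (phi (u - c) y) (v - u) (Linv _ _ Ly) vu.
  rewrite -phiD addrA subrK in h1.
  rewrite -phiD addrA subrK in h2.
  have := le_mdist4 (phi (u + K) x) (phi (u - c) y)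
    (phi (v + K) x) (phi (v - c) y).
  by rewrite -/(f u) -/(f v); lra.
have cf : continuous f.
  apply: continuous_mdist => v.
    apply: (@continuous_comp _ _ _ (fun v : R => v + K) (phi ^~ x)).
      by apply: cvgD; [exact: cvg_id|exact: cvg_cst].
    exact: flow_continuous_time.
  apply: (@continuous_comp _ _ _ (fun v : R => v - c) (phi ^~ y)).
    by apply: cvgB; [exact: cvg_id|exact: cvg_cst].
  exact: flow_continuous_time.
have f0 v : 0 <= f v by exact: mdist_ge0.
have [ueb|beu] := leP (u + eta) b.
  have : e / 3 * (u + eta - u) <= \int[lebesgue_measure]_(v in `[a, b]) f v.
    apply: Rintegral_ge_subitv => //; first lra.
    by move=> v /andP[h1 h2]; apply: far; rewrite ger0_norm; lra.
  by rewrite [u + eta]addrC addrK leNgt int_lt.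
have : e / 3 * (u - (u - eta)) <= \int[lebesgue_measure]_(v in `[a, b]) f v.
  apply: Rintegral_ge_subitv => //; [lra|lra|].
  by move=> v /andP[h1 h2]; apply: far; rewrite ler0_norm; lra.
by rewrite subKr leNgt int_lt.
Qed.

End Flow.

(** The point [p] is an omega-limit point of [x]; [s] may be negative, so that
    the forward orbit of [x] comes back close to the whole past of [p]. *)
Lemma omega_limit_orbit (R : realType) (M : metricType R) (phi : R -> M -> M)
    (L : set M) (x : M) :
  continuous_flow phi -> compact L -> (forall t x, L x -> L (phi t x)) -> L x ->
  exists2 p, L p & forall s e, 0 < e ->
    exists2 a, 1 <= a & mdist (phi a x) (phi s p) < e.
Proof.
move=> flow compactL invL Lx.
have [|p [Lp clp]] := compactL ((fun n : nat => phi n%:R x) @ \oo) _.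
  by exists 0%N => // n _; exact: invL.
exists p => // s e e0.
have np : \forall y \near p, mdist (phi s p) (phi s y) < e.
  have c : phi s @ p --> phi s p by exact: flow_continuous_space.
  exact: (metricType_numDomainType.cvgr_dist_lt c).
pose N := (Num.truncn (`|s| + 1)).+1.
have AN : ((fun n : nat => phi n%:R x) @ \oo)
    [set phi n%:R x | n in [set n | (N <= n)%N]].
  by exists N => // n Nn; exists n.
have [_ [[n Nn <-] /= sn]] := clp _ _ AN np.
exists (s + n%:R); last by case: flow => _ -> _; rewrite metric_sym.
have : `|s| + 1 < N%:R by exact: truncnS_gt.
have : N%:R <= n%:R :> R by rewrite ler_nat.
by have := ler_norm (- s); rewrite normrN; lra.
Qed.

(** * Finite pseudo orbits *)

(** A pair [(x, t)] stands for the orbit piece that starts at [x] and lasts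
    [t]. *)
Definition piece_in (R : realType) (M : metricType R) (K : set M) :
    pred (M * R) :=
  fun p => (p.1 \in K) && (1 <= p.2).

Definition link (R : realType) (M : metricType R) (phi : R -> M -> M) (e : R) :
    rel (M * R) :=
  fun p q => mdist (phi p.2 p.1) q.1 < e.

(** Tracing without reparametrization: the orbit of [z] is run at the same speed
    as the pieces, one after the other. *)
Fixpoint traces (R : realType) (M : metricType R) (phi : R -> M -> M) (e : R)
    (z : M) (s : seq (M * R)) : Prop :=
  if s is p :: s' then
    (forall u, 0 <= u <= p.2 -> mdist (phi u z) (phi u p.1) < e) /\
    traces phi e (phi p.2 z) s'
  else True.

Definition elapsed (R : realType) (t : nat -> R) (n : nat) : R :=
  \sum_(0 <= k < n) t k.

Lemma path_iota (T : Type) (r : rel T) (f : nat -> T) n m :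
  (forall k, r (f k) (f k.+1)) -> path r (f n) [seq f i | i <- iota n.+1 m].
Proof. by move=> h; elim: m n => //= m IH n; rewrite h IH. Qed.

(** The blocks are nonempty and given as head and tail.  The relations [r k] are
    those of pseudo orbits with smaller and smaller jumps, so that from position
    [pos k] on only the jumps allowed in block [k] or later occur: this makes
    the concatenation a limit-pseudo orbit. *)
Lemma concat_blocks (T : Type) (P : pred T) (r : nat -> rel T)
    (B : nat -> T * seq T) :
  (forall k, all P ((B k).1 :: (B k).2)) ->
  (forall k, path (r k) (B k).1 (B k).2) ->
  (forall k, r k (last (B k).1 (B k).2) (B k.+1).1) ->
  exists (f : nat -> T) (pos : nat -> nat),
    [/\ forall n, P (f n),
        forall k, (k <= pos k)%N,
        forall k n, (pos k <= n)%N ->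
          exists2 j, (k <= j)%N & r j (f n) (f n.+1)
      & forall k, [seq f n | n <- iota (pos k) (size (B k).2).+1] =
          (B k).1 :: (B k).2].
Proof.
move=> PB pathB linkB.
(* A state is the index of the current block, its current element, and what
   remains of it. *)
pose step (s : nat * (T * seq T)) :=
  if s.2.2 is q :: u then (s.1, (q, u)) else (s.1.+1, B s.1.+1).
pose st n := iter n step (0%N, B 0%N).
pose f n := (st n).2.1.
pose pos k := (\sum_(j < k) (size (B j).2).+1)%N.
have run u : forall k p n, st n = (k, (p, u)) ->
    [seq f i | i <- iota n (size u).+1] = p :: u /\
    st (n + (size u).+1)%N = (k.+1, B k.+1).
  elim: u => [|q u IH] k p n stn /=.
    by rewrite addn1 /st iterS -/(st n) stn /f stn.
  have stS : st n.+1 = (k, (q, u)) by rewrite /st iterS -/(st n) stn.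
  have [IH1 IH2] := IH _ _ _ stS.
  rewrite addnS -addSn IH2; split=> //; rewrite {1}/f stn; congr (_ :: _).
  exact: IH1.
have stpos k : st (pos k) = (k, ((B k).1, (B k).2)).
  elim: k => [|k IH]; first by rewrite /pos big_ord0 /st /=; case: (B 0%N).
  rewrite /pos big_ord_recr -/(pos k) /=; have [_ ->] := run _ _ _ _ IH.
  by case: (B k.+1).
have inv n : [/\ all P ((st n).2.1 :: (st n).2.2),
    path (r (st n).1) (st n).2.1 (st n).2.2 &
    r (st n).1 (last (st n).2.1 (st n).2.2) (B (st n).1.+1).1].
  elim: n => [|n]; first by split; [exact: PB|exact: pathB|exact: linkB].
  rewrite /st iterS -/(st n) /step; case: (st n) => k [p [|q u]] /=.
    by move=> _; split; [exact: PB|exact: pathB|exact: linkB].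
  by case=> /andP[_ ?] /andP[_ ?] ?; split.
have mono n m : ((st n).1 <= (st (n + m)).1)%N.
  elim: m => [|m IH]; first by rewrite addn0.
  apply: (leq_trans IH); rewrite addnS /st iterS -/(st _) /step.
  by case: (st _) => k [p [|q u]] /=.
exists f, pos; split.
- by move=> n; have [/andP[]] := inv n.
- move=> k; rewrite -[leqLHS]card_ord -sum1_card; exact: leq_sum.
- move=> k n kn; exists (st n).1.
    by have := mono (pos k) (n - pos k)%N; rewrite subnKC// stpos.
  rewrite /f {3}/st iterS -/(st n) /step.
  by have [_] := inv n; case: (st n) => j [p [|q u]] //= /andP[].
- by move=> k; have [-> _] := run _ _ _ _ (stpos k).
Qed.

(** * Consequences of limit shadowing with a gap *)

Section Gap.
Context {R : realType} {M : metricType R} {phi : R -> M -> M} {L : set M}.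
Hypothesis flow : continuous_flow phi.
Hypothesis compactL : compact L.
Hypothesis invL : forall t x, L x -> L (phi t x).
Hypothesis gap : limit_shadowing_with_a_gap phi L.

Let phi0 x : phi 0 x = x. Proof. by case: flow. Qed.
Let phiD s t x : phi (s + t) x = phi s (phi t x). Proof. by case: flow. Qed.

Lemma traces_cat e z s1 s2 : traces phi e z (s1 ++ s2) ->
  traces phi e z s1 /\ exists T, traces phi e (phi T z) s2.
Proof.
elim: s1 z => [|p s1 IH] z /=.
  by move=> h; split=> //; exists 0; rewrite phi0.
move=> [h /IH[h1 [T hT]]]; split=> [|]; first by split.
by exists (T + p.2); rewrite phiD.
Qed.

Lemma traces_iotaP e z (f : nat -> M * R) n m :
  traces phi e z [seq f i | i <- iota n m] <->
  forall i u, (i < m)%N -> 0 <= u <= (f (n + i)%N).2 ->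
    mdist (phi (\sum_(n <= k < n + i) (f k).2 + u) z)
      (phi u (f (n + i)%N).1) < e.
Proof.
elim: m n z => [|m IH] n z /=; first by [].
have sumS i : \sum_(n <= k < n + i.+1) (f k).2 =
    \sum_(n.+1 <= k < n.+1 + i) (f k).2 + (f n).2.
  by rewrite big_ltn ?addnS ?ltnS ?leq_addr// addrC addSn.
split=> [[h0 /IH h] [|i] u im|h].
- by rewrite addn0 big_geq// add0r; exact: h0.
- by rewrite sumS addrAC phiD -addSnnS; exact: h.
- split=> [u hu|].
    by have := h 0%N u isT; rewrite addn0 big_geq// add0r; exact.
  apply/IH => i u im; have := h i.+1 u im.
  by rewrite sumS addrAC phiD -addSnnS.
Qed.

(** The pieces [(x n, t n)], preceded by the past of [p] cut into pieces of
    length 1, form a two-sided limit-pseudo orbit, whatever the jump from [p] to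
    [x 0]. *)
Lemma limit_shadowing_joins (p : M) (x : nat -> M) (t : nat -> R) :
  L p -> (forall n, L (x n)) -> (forall n, 1 <= t n) ->
  (forall e, 0 < e -> exists N, forall n, (N <= n)%N ->
    mdist (phi (t n) (x n)) (x n.+1) < e) ->
  exists K z, [/\ L z,
    forall e, 0 < e -> exists N, forall n u, (N <= n)%N -> 0 <= u <= t n ->
      mdist (phi (K + elapsed t n + u) z) (phi u (x n)) < e
  & forall e, 0 < e -> exists T, forall s, T <= s ->
      mdist (phi (- s) z) (phi (- s) p) < e].
Proof.
move=> Lp Lx t1 lim.
pose xx (i : int) :=
  match i with Posz n => x n | Negz n => phi (- n.+1%:R) p end.
pose tt (i : int) := match i with Posz n => t n | Negz n => 1 end.
have xxN n : phi 1 (xx (Negz n)) = if n is m.+1 then xx (Negz m) else p.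
  rewrite /xx -phiD; case: n => [|n]; first by rewrite subrr phi0.
  by congr (phi _ p); rewrite -[n.+2%:R]natr1; lra.
have NegzS n : Negz n.+1 + 1 = Negz n by rewrite !NegzE; lia.
have lpo : limit_pseudo_orbit phi xx tt.
  split=> [[n|n]//=|e e0].
  have [N HN] := lim _ e0; exists N.+2 => -[n|n] Nn.
    have -> : Posz n + 1 = n.+1%:Z by lia.
    by apply: HN; move: Nn; rewrite /=; lia.
  case: n Nn => [|n] Nn; first by move: Nn; rewrite /=; lia.
  by rewrite NegzS [phi _ _]xxN mdistxx.
have Lxx i : L (xx i) by case: i => n //=; exact: invL.
have [N0 _ /(_ _ _ lpo Lxx)[K _ [z Lz [fwd bwd]]]] := gap.
exists K, z; split=> // e e0.
  have [d d0 Hd] := uniform_of_small_integral flow compactL invL e0.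
  have [N _ HN] := (cvgrPdist_lt _ _).1 fwd _ d0.
  exists N => n u Nn /andP[u0 ut].
  have eqS : abs_time tt (n%:Z + 1) = abs_time tt n%:Z + t n.
    by rewrite -PoszD addn1 /= big_nat_recr.
  have := Hd z (x n) (abs_time tt n%:Z) (abs_time tt (n%:Z + 1)) K
    (abs_time tt n%:Z) Lz (Lx n).
  have -> : abs_time tt (n%:Z + 1) - abs_time tt n%:Z = t n by rewrite eqS; lra.
  move=> /(_ (t1 n)) H.
  have int_lt := HN n Nn; rewrite /= sub0r normrN in int_lt.
  have := H (le_lt_trans (ler_norm _) int_lt) (abs_time tt n%:Z + u).
  rewrite eqS lerDl lerD2l u0 ut => /(_ isT).
  have -> : abs_time tt n%:Z + u - abs_time tt n%:Z = u by lra.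
  by rewrite [_ + K]addrC addrA.
have [d d0 Hd] := uniform_of_small_integral flow compactL invL e0.
have [N _ HN] := (cvgrPdist_lt _ _).1 bwd _ d0.
have absN i : abs_time tt (- i%:Z) = i%:R.
  case: i => [|i]; first by rewrite oppr0 /= big_geq.
  rewrite -NegzE /=.
  by rewrite (eq_bigr (fun=> 1)) ?sumr_const_nat ?subn0.
have xxM i : xx (- i%:Z) = if i is m.+1 then phi (- m.+1%:R) p else x 0%N.
  by case: i => [|i]; rewrite ?oppr0 -?NegzE.
exists N%:R => s Ns.
have s0 : 0 <= s by rewrite (le_trans _ Ns).
have /andP[ms sm] := truncn_itv s0.
(* The time [- s] lies in the unit piece that starts at [- m.+1]. *)
set m := Num.truncn s in ms sm.
have Nm : (N <= m.+1)%N by rewrite -(ler_nat R) (le_trans Ns)// ltW.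
have := HN _ Nm; rewrite sub0r normrN.
have -> : - (m.+1%:Z - 1) = - m%:Z by lia.
rewrite !absN xxM => int_lt.
have := Hd z (phi (- m.+1%:R) p) (- m.+1%:R) (- m%:R) 0 (- m.+1%:R)
  Lz (invL _ Lp).
have -> : - m%:R - (- m.+1%:R) = 1 :> R by rewrite -natr1; lra.
move=> /(_ (lexx _)) H.
have /H : \int[lebesgue_measure]_(u in `[(- m.+1%:R), (- m%:R)])
    mdist (phi (u + 0) z) (phi (u - - m.+1%:R) (phi (- m.+1%:R) p)) < d.
  apply: le_lt_trans int_lt; apply: le_trans (ler_norm _).
  by under eq_Rintegral do rewrite addr0 opprK.
move=> /(_ (- s)); rewrite addr0 opprK -phiD.
rewrite addrK; apply.
by rewrite !lerN2 ms ltW.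
Qed.

(** Chain transitivity of [L]: a pseudo orbit ending with the piece [q] can be
    continued so as to arrive exactly at [y].  With [p] an omega-limit point of
    the end point of [q], and [p'] an alpha-limit point of [y], the three added
    pieces follow the end point of [q] up to the past of [p], a point [z] from
    the past of [p] to the future of [p'], and the past of [y]. *)
Lemma connecting_chain (q : M * R) (y : M) (e : R) : L q.1 -> L y -> 0 < e ->
  exists s : seq (M * R), [/\ all (piece_in L) s, path (link phi e) q s &
    phi (last q s).2 (last q s).1 = y].
Proof.
move=> Lq Ly e0; set x := phi q.2 q.1.
have Lx : L x by exact: invL.
have e20 : 0 < e / 2 by rewrite divr_gt0.
have [p Lp wp] := omega_limit_orbit flow compactL invL Lx.
have [p' Lp' ap] := omega_limit_orbit (reverse_flow flow) compactL
  (fun t x => invL (- t) (x := x)) Ly.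
have [|n|N|K [z [Lz fwd bwd]]] := limit_shadowing_joins
  (x := fun n => phi n%:R p') (t := fun=> 1) Lp.
- by move=> n; exact: invL.
- exact: lexx.
- move=> e1; exists 0%N => n _; rewrite -phiD addrC natr1 mdistxx; exact: e1.
have [N HN] := fwd _ e20.
have [T HT] := bwd _ e20.
(* Late enough for both asymptotics, and making the middle piece, of length
   [K + m + m], last at least 1. *)
pose m := maxn N (Num.truncn (`|T| + `|K| + 1)).+1.
have Nm : (N <= m)%N by rewrite leq_maxl.
have mT : `|T| + `|K| + 1 < m%:R.
  by apply: (lt_le_trans (truncnS_gt _)); rewrite ler_nat leq_maxr.
have hT := ler_norm T; have hK := ler_norm (- K); rewrite normrN in hK.
have nT := normr_ge0 T; have nK := normr_ge0 K.
have fm := HN m 0 Nm; rewrite lexx ler01 in fm.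
have {}fm := fm isT.
have bm : mdist (phi (- m%:R) z) (phi (- m%:R) p) < e / 2 by apply: HT; lra.
have [a a1 ha] := wp (- m%:R) _ e20.
have [c c1 hc] := ap (- m%:R) _ e20.
exists [:: (x, a); (phi (- m%:R) z, K + m%:R + m%:R); (phi (- c) y, c)].
split.
- rewrite /= /piece_in /= !mem_set ?a1 ?c1//=; last exact: invL.
  + by rewrite andbT; lra.
  + exact: invL.
- rewrite /= /link /= -/x mdistxx e0 andbT /=; apply/andP; split.
    have := metric_triangle (phi a x) (phi (- m%:R) p) (phi (- m%:R) z).
    by rewrite [mdist (phi (- m%:R) p) _]metric_sym; lra.
  have := metric_triangle (phi (K + m%:R) z) (phi m%:R p') (phi (- c) y).
  rewrite phi0 /elapsed sumr_const_nat subn0 addr0 in fm.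
  rewrite -phiD addrK [mdist (phi m%:R p') _]metric_sym.
  by rewrite opprK in hc; lra.
- by rewrite /= -phiD subrr phi0.
Qed.

(** Untraced blocks with smaller and smaller jumps, linked by chains, would form
    a limit-pseudo orbit; but limit shadowing traces its late blocks. *)
Lemma finite_shadowing (e : R) : 0 < e -> exists2 d : R, 0 < d &
  forall q s, all (piece_in L) (q :: s) -> path (link phi d) q s ->
  exists2 z, L z & traces phi e z (q :: s).
Proof.
move=> e0; apply: contrapT => nosh.
have bad k : exists b : (M * R) * seq (M * R),
    [/\ all (piece_in L) (b.1 :: b.2), path (link phi k.+1%:R^-1) b.1 b.2 &
       forall z, L z -> ~ traces phi e z (b.1 :: b.2)].
  apply: contrapT => nobad; apply: nosh.
  exists k.+1%:R^-1; first by rewrite invr_gt0.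
  move=> q s hL hs; apply: contrapT => notrace; apply: nobad.
  by exists (q, s); split=> //= z Lz tz; apply: notrace; exists z.
have [b {}bad] := choice bad.
have lastL k : L (last (b k).1 (b k).2).1.
  have [/allP/(_ _ (mem_last _ _))] := bad k.
  by move=> /andP[/set_mem].
have headL k : L (b k).1.1.
  by have [/andP[/andP[/set_mem]]] := bad k.
have inv0 k : 0 < k.+1%:R^-1 :> R by rewrite invr_gt0.
have conn k := connecting_chain (lastL k) (headL k.+1) (inv0 k).
have [c {}conn] := choice conn.
have [|||f [pos [Lf lepos linkf blockf]]] := concat_blocks (P := piece_in L)
  (r := fun k => link phi k.+1%:R^-1) (B := fun k => ((b k).1, (b k).2 ++ c k)).
- move=> k /=; rewrite all_cat andbA.
  by have [/= -> _ _] := bad k; have [-> _ _] := conn k.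
- move=> k /=; rewrite cat_path.
  by have [_ -> _] := bad k; have [_ -> _] := conn k.
- move=> k /=; rewrite last_cat /link; have [_ _ ->] := conn k.
  by rewrite mdistxx inv0.
have Lf1 n : L (f n).1 by have /andP[/set_mem] := Lf n.
have f2 n : 1 <= (f n).2 by have /andP[] := Lf n.
have [|K [z [Lz fwd _]]] := limit_shadowing_joins
  (x := fun n => (f n).1) (t := fun n => (f n).2) (Lf1 0%N) Lf1 f2.
  move=> d d0; exists (pos (Num.truncn d^-1)) => n /linkf[j kj].
  move=> /lt_trans; apply.
  rewrite invf_plt ?posrE//; apply: (lt_le_trans (truncnS_gt _)).
  by rewrite ler_nat.
have [N HN] := fwd _ e0.
have [_ _] := bad N.
move=> /(_ (phi (K + elapsed (fun n => (f n).2) (pos N)) z) (invL _ Lz)); apply.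
have := blockf N; rewrite /= -cat_cons => blockN.
have [|//] := @traces_cat e (phi (K + elapsed (fun n => (f n).2) (pos N)) z)
  ((b N).1 :: (b N).2) (c N).
rewrite -blockN -[_ :: _]/[seq f i | i <- iota (pos N) _.+1].
apply/traces_iotaP => i u _ hu; rewrite -phiD.
have := HN (pos N + i)%N u (leq_trans (lepos N) (leq_addr _ _)) hu.
rewrite {1}/elapsed (big_cat_nat (leq0n _) (leq_addr i (pos N)))/=.
rewrite -/(elapsed _ _); set S := \sum_(pos N <= k < _) _.
by rewrite [S + u + _]addrC addrA addrA.
Qed.

(** A chain from [x] to [y] is traced by an orbit that starts close to [x] and
    later passes close to [y]. *)
Lemma transitive_of_gap : topologically_transitive phi L.
Proof.
move=> _ _ [U oU ->] [V oV ->] [x [Lx Ux]] [y [Ly Vy]].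
have /metricType_numDomainType.nbhs_mdistP[d1 /= d10 xU] : nbhs x U.
  exact: open_nbhs_nbhs.
have /metricType_numDomainType.nbhs_mdistP[d2 /= d20 yV] : nbhs y V.
  exact: open_nbhs_nbhs.
pose e := Num.min d1 d2.
have e0 : 0 < e by rewrite lt_min d10.
have [d d0 fsh] := finite_shadowing e0.
have [s [sL sl sy]] := connecting_chain (q := (x, 1)) Lx Ly d0.
have [||z Lz] := fsh (x, 1) (rcons s (y, 1)).
- by rewrite /= all_rcons sL andbT /piece_in /= !mem_set// ?lexx /=.
- by rewrite rcons_path sl /link sy mdistxx.
rewrite -cats1 -cat_cons => /traces_cat[[zx _] [T [zy _]]].
exists T, (phi T z); split; last first.
  split; first exact: invL.
  apply: yV; rewrite /= metric_sym.
  have := zy 0; rewrite !phi0 lexx ler01 => /(_ isT) h.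
  by apply: (lt_le_trans h); rewrite ge_min lexx orbT.
exists z => //; split=> //.
apply: xU; rewrite /= metric_sym.
have := zx 0; rewrite !phi0 lexx ler01 => /(_ isT) h.
by apply: (lt_le_trans h); rewrite ge_min lexx.
Qed.

Lemma signed_timeS (t : int -> nat) i :
  signed_time R t (i + 1) = signed_time R t i + (t i)%:R.
Proof.
rewrite /signed_time; case: i => [n|[|n]].
- by rewrite -PoszD addn1 /= big_nat_recr.
- by rewrite /= big_geq// big_nat1 addNr.
- have -> : Negz n.+1 + 1 = Negz n by rewrite !NegzE; lia.
  by rewrite /= [in RHS]big_nat_recr//= opprD subrK.
Qed.

Lemma signed_time_sum (t : int -> nat) m j :
  \sum_(0 <= k < j) (t (k%:Z - m%:Z))%:R =
  signed_time R t (j%:Z - m%:Z) - signed_time R t (- m%:Z).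
Proof.
elim: j => [|j IH]; first by rewrite big_geq// sub0r subrr.
have -> : j.+1%:Z - m%:Z = j%:Z - m%:Z + 1 by lia.
by rewrite big_nat_recr//= IH signed_timeS addrAC.
Qed.

(** The reparametrization is the identity.  For each [m] the window of indices
    from [- m] to [m] is traced by an orbit of [L], whose point at time 0 is
    [w m]; a cluster point of the sequence [w] traces every window. *)
Lemma shadowing_of_gap : shadowing_property phi L.
Proof.
move=> e e0; have e20 : 0 < e / 2 by rewrite divr_gt0.
have [d d0 fsh] := finite_shadowing e20; exists d => // x t po Lx.
(* Tracing at scale [e / 2]: the passage to the cluster point costs the other
   half. *)
have win m : exists w, L w /\ forall (i : int) (u : R), (`|i| <= m)%N ->
    signed_time R t i <= u <= signed_time R t (i + 1) ->
    mdist (phi u w) (phi (u - signed_time R t i) (x i)) < e / 2.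
  pose f k := (x (k%:Z - m%:Z), (t (k%:Z - m%:Z))%:R : R).
  have [||z Lz] := fsh (f 0%N) [seq f i | i <- iota 1 (m + m)].
  - rewrite -map_cons (_ : 0%N :: _ = iota 0 (m + m).+1)// all_map.
    apply/allP => k _ /=; rewrite /piece_in /= mem_set ?ler1n//.
    by have [-> _] := po (k%:Z - m%:Z).
  - apply: path_iota => k; rewrite /link /f /=.
    have [_] := po (k%:Z - m%:Z).
    by have -> : k%:Z - m%:Z + 1 = k.+1%:Z - m%:Z by lia.
  rewrite -map_cons (_ : 0%N :: _ = iota 0 (m + m).+1)// => /traces_iotaP tr.
  (* The orbit of [z] starts with the window, at time
     [signed_time R t (- m%:Z)]; shift it so that time 0 is the common origin. *)
  exists (phi (- signed_time R t (- m%:Z)) z); split; first exact: invL.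
  move=> i u im hu.
  pose k := absz (i + m%:Z).
  have ki : k%:Z - m%:Z = i by rewrite /k; lia.
  have := tr k (u - signed_time R t i); rewrite add0n /f /= ki.
  rewrite signed_time_sum ki; move=> H.
  have /H {}H : (k < (m + m).+1)%N by rewrite /k; lia.
  have : 0 <= u - signed_time R t i <= (t i)%:R.
    by move: hu; rewrite signed_timeS => /andP[h1 h2]; apply/andP; split; lra.
  move=> /H; rewrite -phiD.
  by rewrite addrC addrA subrK.
have [w {}win] := choice win.
have [|z [Lz clz]] := @compactL (w @ \oo) _.
  by exists 0%N => // n _; have [] := win n.
exists z => //; exists id; split=> //.
  split=> //; exists id; split=> //; move=> ?; exact: cvg_id.
move=> i u hu.
have nz : \forall y \near z, mdist (phi u z) (phi u y) < e / 2.
  have c : phi u @ z --> phi u z by exact: flow_continuous_space.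
  exact: (metricType_numDomainType.cvgr_dist_lt c).
have Aw : (w @ \oo) [set w n | n in [set n | (`|i| <= n)%N]].
  by exists `|i|%N => // n Nn; exists n.
have [_ [[n Nn <-] /= sn]] := clz _ _ Aw nz.
have [_ /(_ i u Nn hu) h] := win n.
have := metric_triangle (phi u z) (phi u (w n))
  (phi (u - signed_time R t i) (x i)).
by lra.
Qed.

End Gap.

Theorem theorem2p10 (R : realType) (n : nat) (hn : (3 <= n)%N)
    (M : metricType R) (A : smooth_atlas R n M) (g : riemannian_metric A)
    (hM : closed_riemannian_manifold g)
    (X : vector_field A) (hX : C1_vector_field X)
    (phi : R -> M -> M) (hphi : is_flow_of X phi)
    (L : set M) (hLc : compact L) (hLi : isolated_set phi L)
    (hLp : ~ is_periodic_orbit X phi L) (hLs : ~ is_singularity_set X L)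
    (hgap : limit_shadowing_with_a_gap phi L) :
  topologically_transitive phi L /\ shadowing_property phi L.
Proof.
have flow : continuous_flow phi by case: hphi.
have invL t x : L x -> L (phi t x).
  by case: hLi => inv _ Lx; rewrite -(inv t); exists x.
split; first exact: transitive_of_gap.
exact: shadowing_of_gap.
Qed.
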